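(* Let $\mathbb{F}_q$ be a finite field with $q$ elements, let $n\ge 1$, let $w_0,\dots,w_n$ be positive integers, and let $X=\mathbb{P}(w_0,\dots,w_n)$ be the weighted projective space over $\overline{\mathbb{F}}_q$. Let $Y_Q=\{[t_0^{w_0}:\cdots:t_n^{w_n}] : t_i\in\mathbb{F}_q^*\}\subset X$ (the subgroup of the torus $T_X$ corresponding to $Q=\mathrm{diag}(w_0,\dots,w_n)$). For $i=0,1,\dots,n$ put $$\tilde w_i=\frac{w_i}{\gcd(q-1,w_i)},\qquad d_i=\frac{q-1}{\gcd(q-1,w_i)}.$$ Suppose $w_0\mid q-1$, and let $F_i=x_i^{d_i}-x_0^{d_0\tilde w_i}$ for $i=1,\dots,n$. Then the vanishing ideal of $Y_Q$ in $S=\mathbb{F}_q[x_0,\dots,x_n]$ is $$I(Y_Q)=\langle F_1,F_2,\dots,F_n\rangle,$$ and this ideal is a complete intersection lattice ideal.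
   Context: Standing assumption on the weights: any $n$ of the integers $w_0,\dots,w_n$ have no common divisor greater than $1$. The weighted projective space is $\mathbb{P}(w_0,\dots,w_n)=(\overline{\mathbb{F}}_q^{\,n+1}\setminus\{0\})/G$ with $G=\{(\lambda^{w_0},\dots,\lambda^{w_n}):\lambda\in\overline{\mathbb{F}}_q^*\}$ acting by componentwise multiplication; $[p_0:\cdots:p_n]$ is the orbit of $(p_0,\dots,p_n)$. The torus $T_X$ consists of the orbits with all coordinates nonzero. The ring $S=\mathbb{F}_q[x_0,\dots,x_n]$ is graded by $\deg x_i=w_i$, and homogeneous means homogeneous for this grading. For a subset $Y$ of the $\mathbb{F}_q$-rational points of $X$, the vanishing ideal $I(Y)\subset S$ is the ideal generated by all homogeneous polynomials vanishing at every point of $Y$. For a lattice (subgroup) $L\subset\mathbb{Z}^{n+1}$, the lattice ideal is $I_L=\langle \mathbf{x}^{\mathbf a}-\mathbf{x}^{\mathbf b} : \mathbf a,\mathbf b\in\mathbb{N}^{n+1},\ \mathbf a-\mathbf b\in L\rangle\subset S$; an ideal is a lattice ideal if it equals $I_L$ for some such $L$. A binomial is a polynomial of the form $\mathbf{x}^{\mathbf a}-\mathbf{x}^{\mathbf b}$. A binomial ideal $J$ is a complete intersection if it is generated by $\mathrm{height}(J)$ many binomials. *)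

(* Defs.v *)
From HB Require Import structures.
From mathcomp Require Import all_boot all_order all_algebra all_field.
From mathcomp Require Import boolp classical_sets.
From mathcomp Require Import mpoly.

Set Implicit Arguments.
Unset Strict Implicit.
Unset Printing Implicit Defensive.

Import GRing.Theory.
Local Open Scope ring_scope.
Local Open Scope classical_set_scope.

Section Ideals.
Context {S : comNzRingType}.
Implicit Types (I J P : set S) (A : set S) (r : nat).

(* The unit ideal is allowed, unlike with [idealr_closed]. *)
Definition is_ideal I : Prop :=
  [/\ I 0, forall f g, I f -> I g -> I (f + g) & forall a f, I f -> I (a * f)].

Definition ideal_gen A : set S :=
  [set f | forall I, is_ideal I -> A `<=` I -> I f].

Definition prime_ideal P : Prop :=
  idealr_closed (mem P) /\ prime_idealr_closed (mem P).

(* A chain C_0 < C_1 < ... < C_r = P of prime ideals. *)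
Definition prime_chain P r : Prop :=
  exists C : 'I_r.+1 -> set S,
    [/\ forall i, prime_ideal (C i),
        forall i j : 'I_r.+1, (i < j)%N -> C i `<` C j
      & C ord_max = P].

(* The supremum of the lengths of the chains ending at P is the number r. *)
Definition prime_height P r : Prop :=
  prime_chain P r /\ forall s, prime_chain P s -> (s <= r)%N.

(* The height of J is the minimum of the heights of the primes containing J;
   a prime of infinite height satisfies no [prime_height P s] and so does not
   constrain the minimum. *)
Definition ideal_height J r : Prop :=
  (exists P, [/\ prime_ideal P, J `<=` P & prime_height P r]) /\
  forall P s, prime_ideal P -> J `<=` P -> prime_height P s -> (r <= s)%N.

End Ideals.

Section Binomials.
Context {F : fieldType} {m : nat}.
Implicit Types (f : {mpoly F[m]}) (J : set {mpoly F[m]}).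

Definition is_binomial f : Prop :=
  exists a b : 'X_{1..m}, f = 'X_[a] - 'X_[b].

Definition complete_intersection J : Prop :=
  exists2 r, ideal_height J r &
    exists g : 'I_r -> {mpoly F[m]},
      [/\ injective g, forall k, is_binomial (g k) & J = ideal_gen (range g)].

Definition lattice_ideal_of (L : set 'rV[int]_m) : set {mpoly F[m]} :=
  ideal_gen [set f | exists a b : 'X_{1..m},
    L (\row_i ((a i)%:Z - (b i)%:Z)) /\ f = 'X_[a] - 'X_[b]].

Definition is_lattice_ideal J : Prop :=
  exists2 L : set 'rV[int]_m, zmod_closed (mem L) & J = lattice_ideal_of L.

End Binomials.

Section WeightedDegree.
Context {m : nat} (w : 'I_m -> nat).

Definition wdeg (a : 'X_{1..m}) : nat := (\sum_(i < m) a i * w i)%N.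

Lemma wdeg0 : wdeg 0%MM = 0%N.
Proof. by rewrite /wdeg big1 // => i _; rewrite mnm0E mul0n. Qed.

Lemma wdegD : {morph wdeg : a b / (a + b)%MM >-> (a + b)%N}.
Proof.
move=> a b; rewrite /wdeg -big_split /=.
by apply: eq_bigr => i _; rewrite mnmDE mulnDl.
Qed.

HB.instance Definition _ := isMeasure.Build m wdeg wdeg0 wdegD.

End WeightedDegree.

Section WeightedProjectiveSpace.
Context {K : fieldType} {n : nat} (w : 'I_n.+1 -> nat).

(* The orbit of p under G = {(c^{w_0}, ..., c^{w_n}) : c != 0}. *)
Definition worbit (p : 'rV[K]_n.+1) : set 'rV[K]_n.+1 :=
  [set \row_i (c ^+ w i * p 0 i) | c in [set c : K | c != 0]].

Record wproj := WProj {
  wproj_orbit : set 'rV[K]_n.+1;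
  wproj_orbitP : exists2 p, p != 0 & wproj_orbit = worbit p
}.

End WeightedProjectiveSpace.

Arguments wproj K {n} w.

Section VanishingIdeal.
Context {F K : fieldType} (iota : {rmorphism F -> K}) {n : nat}.
Context (w : 'I_n.+1 -> nat).

(* Quantifying over all representatives is harmless for the homogeneous
   polynomials to which this is applied. *)
Definition vanishes_at (f : {mpoly F[n.+1]}) (P : wproj K w) : Prop :=
  forall p, wproj_orbit P p -> (map_mpoly iota f).@[p 0] = 0.

Definition vanishing_ideal (Y : set (wproj K w)) : set {mpoly F[n.+1]} :=
  ideal_gen [set f | f \is ishomog (wdeg w) /\
                     forall P, Y P -> vanishes_at f P].

Definition YQ : set (wproj K w) :=
  [set P | exists2 t : 'I_n.+1 -> F, forall i, t i != 0 &
           wproj_orbit P = worbit w (\row_i iota (t i ^+ w i))].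

End VanishingIdeal.

Arguments YQ {F K} iota {n} w.

Section Generators.
Context (F : finFieldType) {n : nat} (w : 'I_n.+1 -> nat).

Definition wtilde (i : 'I_n.+1) : nat := (w i %/ gcdn #|F|.-1 (w i))%N.

Definition dexp (i : 'I_n.+1) : nat := (#|F|.-1 %/ gcdn #|F|.-1 (w i))%N.

Definition Fgen (i : 'I_n.+1) : {mpoly F[n.+1]} :=
  'X_i ^+ dexp i - 'X_ord0 ^+ (dexp ord0 * wtilde i).

End Generators.

(* K is an algebraic closure of F through iota. *)
Definition is_algebraic_closure (F : fieldType) (K : closedFieldType)
    (iota : {rmorphism F -> K}) : Prop :=
  forall x : K, algebraicOver iota x.

(* Main.v *)
(* A homogeneous f vanishing on Y_Q vanishes at all points (t_i^{w_i}); by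
   orthogonality of the characters of (F_q^* )^{n+1}, for every residue class of
   exponents modulo (d_0, ..., d_n) the coefficients of f in that class sum to
   zero.  Two monomials of equal weighted degree in the same class are congruent
   modulo J = <F_1, ..., F_n>, so f is in J.  The same congruence gives that
   J is the lattice ideal of {u : sum_i w_i u_i = 0 and d_i | u_i for i >= 1}.

   For the height, let P be a prime containing J.  Each x_i is integral over
   F[x_0] modulo F_i, so replacing x_0, ..., x_k by their classes in S/P gives
   maps S -> (S/P)[x_{k+1}, ..., x_n] whose kernels, k = 0, ..., n, form a chain
   of length n ending at P.  Conversely the kernel of x_i |-> s^{w_i} contains J
   and lies strictly below the ideal of the origin, so its height is at most n
   because the polynomial ring has Krull dimension at most n+1. *)
Require Import Defs.
From HB Require Import structures.
From mathcomp Require Import all_boot all_order all_algebra all_field.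
From mathcomp Require Import boolp classical_sets.
From mathcomp Require Import mpoly ring_quotient cyclic.

Set Implicit Arguments.
Unset Strict Implicit.
Unset Printing Implicit Defensive.

Import GRing.Theory.
Local Open Scope ring_scope.
Local Open Scope classical_set_scope.

(** * Prime ideals as kernels of maps to domains *)

Lemma prime_ideal_ker (S : comNzRingType) (D : idomainType)
    (phi : {rmorphism S -> D}) : prime_ideal [set f | phi f = 0].
Proof.
split; first split; rewrite ?inE /=.
- by rewrite rmorph0.
- by apply/negP; rewrite inE /= rmorph1; apply/eqP; rewrite oner_eq0.
- move=> a u v; rewrite !inE /= => pu pv.
  by rewrite rmorphD rmorphM pu pv mulr0 addr0.
- move=> u v; rewrite !inE /= rmorphM => /eqP; rewrite mulf_eq0.
  by case/orP => /eqP p0; apply/orP; [left|right]; rewrite inE.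
Qed.

Lemma prime_ideal_elim (S : comNzRingType) (P : set S) : prime_ideal P ->
  [/\ is_ideal P, ~ P 1 & forall u v, P (u * v) -> P u \/ P v].
Proof.
case=> -[]; rewrite !inE => P0 /negP P1 Plin Pprime; rewrite inE in P1.
have PD f g : P f -> P g -> P (f + g).
  by move=> Pf Pg; have := Plin 1 f g; rewrite !inE mul1r; apply.
split=> //; first split=> //.
  by move=> a f Pf; have := Plin a f 0; rewrite !inE addr0; apply.
by move=> u v Puv; have := Pprime u v; rewrite !inE => /(_ Puv) /orP [];
  rewrite inE; [left|right].
Qed.

Section PrimeQuotient.
Context (S : comNzRingType) (P : prime_idealr S).

Definition prime_quot := {ideal_quot P}.

HB.instance Definition _ := GRing.ComNzRing.on prime_quot.

(** An [idomainType] carries a boolean unit test and an inverse; on the quotient both are chosen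
    classically, the inverse being the identity off the units. *)
Definition prime_quot_unit (x : prime_quot) : bool := `[< exists y, y * x = 1 >].

Definition prime_quot_inv (x : prime_quot) : prime_quot :=
  if pselect (exists y, y * x = 1) is left h then projT1 (cid h) else x.

Fact prime_quot_mulVx : {in prime_quot_unit, left_inverse 1 prime_quot_inv *%R}.
Proof.
move=> x /asboolP hx; rewrite /prime_quot_inv.
by case: pselect => [h|//]; exact: (projT2 (cid h)).
Qed.

Fact prime_quot_unitPl x y : y * x = 1 -> prime_quot_unit x.
Proof. by move=> yx; apply/asboolP; exists y. Qed.

Fact prime_quot_invr_out : {in [predC prime_quot_unit], prime_quot_inv =1 id}.
Proof.
move=> x /asboolP hx; rewrite /prime_quot_inv.
by case: pselect => [h|//]; case: hx.
Qed.

HB.instance Definition _ := GRing.ComNzRing_hasMulInverse.Build prime_quot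
  prime_quot_mulVx prime_quot_unitPl prime_quot_invr_out.

HB.instance Definition _ := GRing.ComUnitRing_isIntegral.Build prime_quot
  (@Quotient.rquot_IdomainAxiom S P).

End PrimeQuotient.

(** With [prime_ideal_ker] this makes primes interchangeable with kernels of maps to domains, so
    that chains of primes can be built from ring maps. *)
Lemma prime_ideal_is_ker (S : comNzRingType) (P : set S) : prime_ideal P ->
  exists (D : idomainType) (phi : {rmorphism S -> D}), P = [set f | phi f = 0].
Proof.
case=> idP primeP.
pose I : prime_idealr S := HB.pack (fun x : S => x \in P)
  (isIdealr.Build S (fun x : S => x \in P) idP)
  (isPrimeIdealrClosed.Build S (fun x : S => x \in P) primeP).
exists (prime_quot I : idomainType).
pose pi0 (x : S) : prime_quot I := \pi_({ideal_quot I})%qT x.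
have pi_zmod : zmod_morphism pi0 by move=> x y; rewrite /pi0 rmorphB.
have pi_monoid : monoid_morphism pi0.
  by split=> [|x y]; rewrite /pi0 ?rmorph1 ?rmorphM.
pose phi : {rmorphism S -> prime_quot I} := HB.pack pi0
  (GRing.isZmodMorphism.Build _ _ pi0 pi_zmod)
  (GRing.isMonoidMorphism.Build _ _ pi0 pi_monoid).
exists phi; apply/seteqP; split=> x /=.
  move=> Px; rewrite /pi0 -[RHS](rmorph0 (\pi_({ideal_quot I}))%qT).
  by apply/eqP; rewrite -Quotient.idealrBE subr0 inE.
rewrite /pi0 -(rmorph0 (\pi_({ideal_quot I}))%qT) => /eqP.
by rewrite -Quotient.idealrBE subr0 inE.
Qed.

(** * Ideals and congruences *)

Section IdealFacts.
Context {S : comNzRingType}.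
Implicit Types (I A : set S).

Lemma ideal_gen_ideal A : is_ideal (ideal_gen A).
Proof.
split=> [I [I0 _ _] _ //|f g If Ig I idI AI|a f If I idI AI].
  by case: (idI) => _ ID _; apply: ID; [exact: If|exact: Ig].
by case: (idI) => _ _ IM; apply: IM; exact: If.
Qed.

Lemma ideal_gen_sub A : A `<=` ideal_gen A.
Proof. by move=> f Af I _; apply. Qed.

Lemma ideal_gen_min I A : is_ideal I -> A `<=` I -> ideal_gen A `<=` I.
Proof. by move=> idI AI f; apply. Qed.

Lemma is_ideal_sum I (T : eqType) (r : seq T) (P : pred T) (E : T -> S) :
  is_ideal I -> (forall i, i \in r -> P i -> I (E i)) ->
  I (\sum_(i <- r | P i) E i).
Proof.
move=> [I0 ID _] IE; rewrite big_seq_cond.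
by elim/big_ind: _ => // i /andP[]; exact: IE.
Qed.

Lemma is_idealN I f : is_ideal I -> I f -> I (- f).
Proof. by move=> [_ _ IM] If; rewrite -mulN1r; apply: IM. Qed.

Lemma is_idealB I f g : is_ideal I -> I f -> I g -> I (f - g).
Proof.
by move=> idI If Ig; case: (idI) => _ ID _; apply: ID => //; apply: is_idealN.
Qed.

Lemma ideal_cong_mul I x y x' y' : is_ideal I ->
  I (x - x') -> I (y - y') -> I (x * y - x' * y').
Proof.
move=> [_ ID IM] Ix Iy.
have -> : x * y - x' * y' = y * (x - x') + x' * (y - y').
  by rewrite !mulrBr addrA (mulrC y x) (mulrC y x') subrK.
by apply: ID; apply: IM.
Qed.

Lemma ideal_cong_exp I x x' k : is_ideal I -> I (x - x') -> I (x ^+ k - x' ^+ k).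
Proof.
move=> idI Ix; elim: k => [|k IHk]; first by rewrite subrr; case: idI.
by rewrite !exprS; apply: ideal_cong_mul.
Qed.

End IdealFacts.

(** * Character sums over a finite field *)

Section FiniteFieldSums.
Context (F : finFieldType).

Local Notation q1 := #|F|.-1.

Lemma card_pred_gt0 : (0 < q1)%N.
Proof. by have := card_finNzRing_gt1 F; case: #|F| => [|[]]. Qed.

Lemma card_pred_natr : q1%:R = -1 :> F.
Proof.
have F0 : #|F|%:R = 0 :> F.
  (* Translation by 1 permutes [F], so it adds [#|F|] times 1 to the sum without changing it. *)
  have : \sum_(x : F) (x + 1) = \sum_(x : F) x.
    by rewrite [RHS](reindex_inj (addIr 1)).
  move/eqP; rewrite big_split /= sumr_const addrC -subr_eq0 addrK.
  by move/eqP.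
apply/eqP; rewrite -subr_eq0 opprK natr1 prednK ?F0 //.
exact: ltnW (card_finNzRing_gt1 F).
Qed.

Lemma exp_card_pred (t : F) : t != 0 -> t ^+ q1 = 1.
Proof.
move=> t0; apply: (mulfI t0); rewrite -exprS prednK ?expf_card ?mulr1 //.
exact: ltnW (card_finNzRing_gt1 F).
Qed.

(** The summand is the character t^(a-b) of the cyclic group of units. If it is trivial, q-1 = -1
    terms equal to 1 are added; otherwise translation by a generator multiplies the sum by a factor
    other than 1. *)
Lemma sum_units_expr (a b : nat) :
  \sum_(t : F | t != 0) t ^+ a * t^-1 ^+ b = - (a == b %[mod q1])%:R.
Proof.
have unitE (t : F) : t != 0 -> (t ^+ a * t^-1 ^+ b == 1) = (t ^+ a == t ^+ b).
  move=> t0; have tb0 := expf_neq0 b t0.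
  by rewrite exprVn -[1](mulfV tb0) (can_eq (mulfVK _)) ?invr_eq0.
case: (boolP (a == b %[mod q1])) => [/eqP eqab|neqab].
  rewrite (eq_bigr (fun=> 1)) => [|t t0]; last first.
    apply/eqP; rewrite unitE // (divn_eq a q1) (divn_eq b q1) eqab.
    by rewrite !exprD !(mulnC _ q1) !exprM exp_card_pred // !expr1n.
  by rewrite sumr_const cardC1 card_pred_natr.
rewrite oppr0.
have /hasP[z + zprim] : has q1.-primitive_root [seq t <- enum F | t != 0].
  apply: has_prim_root; rewrite ?card_pred_gt0 ?(filter_uniq _ (enum_uniq F)) //.
    apply/allP => t; rewrite mem_filter => /andP[t0 _].
    by apply/unity_rootP; exact: exp_card_pred.
  rewrite -(cardC1 (0 : F)) cardE; apply: uniq_leq_size (enum_uniq _) _ => t.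
  by rewrite !mem_enum mem_filter mem_enum andbT.
rewrite mem_filter => /andP[z0 _].
have neq1 : z ^+ a * z^-1 ^+ b != 1 by rewrite unitE // (eq_prim_root_expr zprim).
set s := \sum_(t | _) _.
have sE : s = z ^+ a * z^-1 ^+ b * s.
  rewrite mulr_sumr {1}/s (reindex_inj (mulfI z0)) /=.
  apply: eq_big => t; first by rewrite mulf_eq0 (negPf z0).
  by move=> _; rewrite invfM !exprMn mulrACA.
have /eqP : (1 - z ^+ a * z^-1 ^+ b) * s = 0 by rewrite mulrBl -sE mul1r subrr.
by rewrite mulf_eq0 subr_eq0 eq_sym (negPf neq1) => /eqP.
Qed.

(* Orthogonality of characters isolates the monomials of [f] that agree with
   [b] as functions of [t]. *)
Lemma sum_coef_residue_class (n : nat) (w : 'I_n -> nat) (f : {mpoly F[n]}) :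
  (forall t : 'I_n -> F, (forall i, t i != 0) -> f.@[fun i => t i ^+ w i] = 0) ->
  forall b : 'I_n -> nat,
  \sum_(a <- msupp f | [forall i, w i * a i == b i %[mod q1]]) f@_a = 0.
Proof.
move=> f0 b; pose nz := [pred t : F | t != 0].
have : \sum_(t : {ffun 'I_n -> F} | t \in ffun_on nz)
    f.@[fun i => t i ^+ w i] * \prod_i (t i)^-1 ^+ b i = 0.
  apply: big1 => t /ffun_onP tnz; rewrite f0 ?mul0r // => i; exact: tnz.
under eq_bigr => t _ do rewrite mevalE mulr_suml.
rewrite exchange_big /=.
(* The sum over the torus factors over the coordinates into [c a], which is the nonzero constant
   (-1)^n on the class of [b] and 0 elsewhere. *)
pose c a := \prod_(i < n) (- (w i * a i == b i %[mod q1])%:R : F).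
rewrite (eq_bigr (fun a : 'X_{1..n} => f@_a * c a)) => [|a _]; last first.
  rewrite /c; under [in RHS]eq_bigr => i _ do rewrite -sum_units_expr.
  rewrite bigA_distr_big mulr_sumr; apply: eq_bigr => t _.
  rewrite -mulrA -big_split /=; congr (_ * _); apply: eq_bigr => i _.
  by rewrite -exprM.
have cE (a : 'X_{1..n}) :
    c a = if [forall i, w i * a i == b i %[mod q1]] then (-1) ^+ n else 0.
  case: ifP => [/forallP eqab|/forallPn[i /negPf neqab]].
    by rewrite /c (eq_bigr (fun=> -1)) ?prodr_const ?card_ord // => i _; rewrite eqab.
  by rewrite /c (bigD1 i) //= neqab oppr0 mul0r.
under eq_bigr => a _ do rewrite cE (fun_if ( *%R f@_a)) mulr0.
rewrite -big_mkcond -mulr_suml /= => /eqP.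
by rewrite mulf_eq0 expf_eq0 oppr_eq0 oner_eq0 andbF orbF => /eqP.
Qed.

End FiniteFieldSums.

(** * Evaluation of polynomials and change of coefficients *)

Section MpolyEval.
Context (n : nat).

Lemma meval_map_mpoly (R S : comNzRingType) (f : {rmorphism R -> S})
    (v : 'I_n -> R) (p : {mpoly R[n]}) :
  (map_mpoly f p).@[fun i => f (v i)] = f p.@[v].
Proof.
elim/mpolyind: p => [|c a p _ _ IHp]; first by rewrite !rmorph0.
rewrite !rmorphD /= map_mpolyZ map_mpolyX !mevalZ !mevalX IHp rmorphM rmorph_prod.
by congr (_ * _ + _); apply: eq_bigr => i _; rewrite rmorphXn.
Qed.

Lemma mevalXUn (R : comNzRingType) (v : 'I_n -> R) i k :
  'X_[U_(i) *+ k].@[v] = v i ^+ k.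
Proof. by rewrite -mpolyXn rmorphXn /= mevalXU. Qed.

End MpolyEval.

(** * The vanishing ideal and the lattice *)

Section Generators.
Context (F : finFieldType) (n : nat) (w : 'I_n.+1 -> nat).
Hypothesis w_gt0 : forall i, (0 < w i)%N.
Hypothesis hw0 : (w ord0 %| #|F|.-1)%N.

Local Notation q1 := #|F|.-1.
Local Notation d := (dexp F w).
Local Notation wt := (wtilde F w).
Local Notation J := (ideal_gen [set Fgen F w i | i in [set i | i != ord0]]).

Lemma dexp_gt0 i : (0 < d i)%N.
Proof.
rewrite divn_gt0 ?gcdn_gt0 ?(card_pred_gt0 F) // dvdn_leq ?(card_pred_gt0 F) //.
exact: dvdn_gcdl.
Qed.

Lemma wtilde_gt0 i : (0 < wt i)%N.
Proof.
rewrite divn_gt0 ?gcdn_gt0 ?(card_pred_gt0 F) // dvdn_leq //.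
exact: dvdn_gcdr.
Qed.

Lemma dexp_weight i : (d i * w i = q1 * wt i)%N.
Proof.
rewrite /dexp /wtilde muln_divA ?dvdn_gcdr //.
by rewrite mulnC muln_divA ?dvdn_gcdl // mulnC.
Qed.

(** This is where [hw0] enters: with [dexp_weight] it gives both monomials of F_i the weight
    [q1 * wt i]. *)
Lemma dexp0_weight : (d ord0 * w ord0 = q1)%N.
Proof. by rewrite /dexp (gcdn_idPr hw0) divnK. Qed.

(** Dividing by gcd(q-1, w_i) leaves the coprime numbers [d i] and [wt i]. Equality of characters
    thus becomes congruence of exponents modulo [d i]. *)
Lemma dvdn_weight i k : (q1 %| w i * k)%N = (d i %| k)%N.
Proof.
have g0 : (0 < gcdn q1 (w i))%N by rewrite gcdn_gt0 (card_pred_gt0 F).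
rewrite -[X in (X %| _)%N](divnK (dvdn_gcdl q1 (w i))).
rewrite -[X in (_ %| X * _)%N](divnK (dvdn_gcdr q1 (w i))).
rewrite mulnAC dvdn_pmul2r // Gauss_dvdr //.
rewrite /coprime -(eqn_pmul2r g0) muln_gcdl !divnK ?dvdn_gcdl ?dvdn_gcdr //.
by rewrite mul1n.
Qed.

Lemma Fgen_in i : i != ord0 -> J (Fgen F w i).
Proof. by move=> i0; apply: ideal_gen_sub; exists i. Qed.

(** Division with remainder by [d i]: each block ['X_i ^+ d i] is traded for a power of ['X_ord0] by
    means of F_i. *)
Lemma mpolyX_normal_form (a : 'X_{1..n.+1}) :
  J ('X_[a] - 'X_ord0 ^+ (a ord0 + \sum_(i | i != ord0)
                            d ord0 * wt i * (a i %/ d i))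
       * \prod_(i | i != ord0) 'X_i ^+ (a i %% d i)).
Proof.
have idJ : is_ideal J by exact: ideal_gen_ideal.
rewrite exprD -mulrA mpolyXE_id (bigD1 ord0) //= -mulrBr.
have JM f g : J g -> J (f * g) by case: (idJ) => _ _; apply.
apply: (JM); pose K (x y : {mpoly F[n.+1]}) k := J (x - 'X_ord0 ^+ k * y).
rewrite -/(K _ _ _); elim/big_ind3: _ => [|x1 y1 k1 x2 y2 k2 K1 K2|i i0].
- by rewrite /K expr0 mul1r subrr; case: idJ.
- by rewrite /K exprD mulrACA; apply: (ideal_cong_mul idJ).
rewrite /K {1}(divn_eq (a i) (d i)) exprD -mulrBl mulrC.
apply: JM; rewrite (mulnC (a i %/ d i)%N) !(exprM _ _ (a i %/ d i)%N).
exact: ideal_cong_exp (a i %/ d i)%N idJ (Fgen_in i0).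
Qed.

(** The normal forms coincide: the remainders agree off index 0, and the exponent of ['X_ord0] is
    then forced, since reduction preserves the weighted degree and [w ord0] is positive. *)
Lemma mpolyX_cong (a b : 'X_{1..n.+1}) : wdeg w a = wdeg w b ->
  (forall i, i != ord0 -> a i = b i %[mod d i]) -> J ('X_[a] - 'X_[b]).
Proof.
move=> eqw eqab; have idJ : is_ideal J by exact: ideal_gen_ideal.
have := is_idealB idJ (mpolyX_normal_form a) (mpolyX_normal_form b).
rewrite (eq_bigr (fun i => 'X_i ^+ (b i %% d i))); last first.
  by move=> i i0; rewrite eqab.
suff deg_nf (c : 'X_{1..n.+1}) :
    ((c ord0 + \sum_(i | i != ord0) d ord0 * wt i * (c i %/ d i)) * w ord0
     + \sum_(i | i != ord0) w i * (c i %% d i) = wdeg w c)%N.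
  suff -> : (a ord0 + \sum_(i | i != ord0) d ord0 * wt i * (a i %/ d i) =
             b ord0 + \sum_(i | i != ord0) d ord0 * wt i * (b i %/ d i))%N.
    by rewrite opprB addrA subrK.
  apply/eqP; rewrite -(eqn_pmul2r (w_gt0 ord0)).
  rewrite -(eqn_add2r (\sum_(i | i != ord0) w i * (b i %% d i))) deg_nf -eqw.
  rewrite -deg_nf eqn_add2l; apply/eqP.
  by apply: eq_bigr => i i0; rewrite eqab.
rewrite /wdeg [RHS](bigD1 ord0) //= mulnDl -addnA; congr addn.
rewrite big_distrl -big_split /=; apply: eq_bigr => i i0.
rewrite [RHS]mulnC {3}(divn_eq (c i) (d i)) mulnDr; congr addn.
rewrite mulnAC (mulnAC (d ord0)) dexp0_weight -dexp_weight.
by rewrite mulnC (mulnC (d i)) mulnCA.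
Qed.

Lemma wdegXn i k : wdeg w (U_(i) *+ k)%MM = (k * w i)%N.
Proof.
rewrite /wdeg (bigD1 i) //= mulmnE mnm1E eqxx mul1n big1 ?addn0 // => j ji.
by rewrite mulmnE mnm1E eq_sym (negPf ji).
Qed.

Lemma FgenE i :
  Fgen F w i = 'X_[U_(i) *+ d i] - 'X_[U_(ord0) *+ (d ord0 * wt i)].
Proof. by rewrite /Fgen !mpolyXn. Qed.

Lemma Fgen_homog i : Fgen F w i \is ishomog (wdeg w).
Proof.
apply: (@homogE _ _ _ (q1 * wt i)); rewrite FgenE.
apply: rpredB; rewrite dhomogX; apply/eqP; rewrite [LHS]wdegXn.
  exact: dexp_weight.
by rewrite mulnAC dexp0_weight.
Qed.

Lemma homog_vanishing_in (f : {mpoly F[n.+1]}) : f \is ishomog (wdeg w) ->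
  (forall t : 'I_n.+1 -> F, (forall i, t i != 0) ->
     f.@[fun i => t i ^+ w i] = 0) -> J f.
Proof.
move=> homf f0; have idJ : is_ideal J by exact: ideal_gen_ideal.
have degE a b : a \in msupp f -> b \in msupp f -> wdeg w a = wdeg w b.
  by case/homogP: homf => D /dhomogP degD /degD -> /degD ->.
(* [res a] records the character of the torus given by the monomial [a], as exponents modulo q-1. *)
pose res (a : 'X_{1..n.+1}) : {ffun 'I_n.+1 -> 'I_q1} :=
  [ffun i => Ordinal (ltn_pmod (w i * a i) (card_pred_gt0 F))].
have resE a r : (res a == r) = [forall i, w i * a i == r i %[mod q1]].
  apply/eqP/forallP => [<- i|h]; first by rewrite ffunE /= modn_mod.
  apply/ffunP => i; rewrite ffunE; apply/val_inj => /=.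
  by rewrite (eqP (h i)) modn_small.
rewrite (mpolyE f) (partition_big res predT) //=.
apply: (is_ideal_sum idJ) => r _ _; under eq_bigl => a do rewrite resE.
have sum0 := sum_coef_residue_class f0 (fun i => r i : nat).
pose in_class (a : 'X_{1..n.+1}) := [forall i, w i * a i == r i %[mod q1]].
case: (boolP (has in_class (msupp f))).
  move=> /hasP[b bf /forallP bres].
  (* The coefficients in the class sum to zero, so the fixed monomial [b] can be subtracted from
     every monomial of the class. *)
  have -> : \sum_(a <- msupp f | [forall i, w i * a i == r i %[mod q1]])
      f@_a *: 'X_[a] = \sum_(a <- msupp f | [forall i, w i * a i == r i %[mod q1]])
      f@_a *: ('X_[a] - 'X_[b]).
    under [RHS]eq_bigr => a _ do rewrite scalerBr.
    by rewrite sumrB -scaler_suml sum0 scale0r subr0.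
  apply: (is_ideal_sum idJ) => a af /forallP ares.
  rewrite -mul_mpolyC; case: (idJ) => _ _; apply.
  apply: mpolyX_cong => [|i i0]; first exact: degE.
  apply/eqP; move: (ares i); rewrite -(eqP (bres i)).
  case/orP: (leq_total (a i) (b i)) => leab.
    rewrite eq_sym (eq_sym (a i %% _)%N) !eqn_mod_dvd ?leq_mul2l ?leab ?orbT //.
    by rewrite -mulnBr dvdn_weight.
  by rewrite !eqn_mod_dvd ?leq_mul2l ?leab ?orbT // -mulnBr dvdn_weight.
rewrite -all_predC => /allP none; rewrite big_seq_cond big1; first by case: idJ.
by move=> a /andP[/none /negP].
Qed.

Lemma vanishing_ideal_YQ (K : fieldType) (iota : {rmorphism F -> K}) :
  vanishing_ideal iota (YQ iota w) = J.
Proof.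
apply/seteqP; split; apply: ideal_gen_min; first exact: ideal_gen_ideal.
- move=> f [homf fY]; apply: homog_vanishing_in => // t t0.
  pose p : 'rV[K]_n.+1 := \row_i iota (t i ^+ w i).
  have p0 : p != 0.
    apply/eqP => /rowP /(_ ord0) /eqP.
    by rewrite !mxE fmorph_eq0 expf_eq0 (negPf (t0 _)) andbF.
  pose P := @WProj K n w (worbit w p) (ex_intro2 _ _ p p0 erefl).
  have Pp : wproj_orbit P p.
    exists 1 => /=; first exact: oner_neq0.
    by apply/rowP => i; rewrite mxE expr1n mul1r.
  have := fY P (ex_intro2 _ _ t t0 erefl) p Pp.
  rewrite (@meval_eq _ _ _ (fun i => iota (t i ^+ w i))) => [|i]; last by rewrite mxE.
  by rewrite meval_map_mpoly => /eqP; rewrite fmorph_eq0 => /eqP.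
- exact: ideal_gen_ideal.
move=> _ [i /= i0 <-]; apply: ideal_gen_sub; split; first exact: Fgen_homog.
move=> P [t t0 PE] p; rewrite PE => -[c /= c0 <-].
rewrite FgenE rmorphB /= !map_mpolyX mevalB !mevalXUn !mxE !exprMn.
(* The contributions of [t] are 1, their exponents being multiples of q-1; each monomial is left
   with c^(q1 * wt i). *)
have texp : iota (t i ^+ w i) ^+ d i = 1.
  rewrite -rmorphXn -exprM mulnC dexp_weight exprM exp_card_pred //.
  by rewrite expr1n rmorph1.
have t0exp : iota (t ord0 ^+ w ord0) ^+ (d ord0 * wt i) = 1.
  by rewrite -rmorphXn -exprM mulnA (mulnC (w _)) dexp0_weight exprM
    exp_card_pred // expr1n rmorph1.
rewrite texp t0exp !mulr1 -!exprM !(mulnC (w _)) dexp_weight.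
by rewrite (mulnAC (d ord0)) dexp0_weight subrr.
Qed.

(** Divisibility of the entry at index 0 by [d ord0] follows: [q1] divides w_i u_i for every other
    i, hence also w_0 u_0. *)
Definition YQ_lattice : set 'rV[int]_n.+1 :=
  [set u | \sum_i (w i)%:Z * u 0 i = 0 /\
           forall i, i != ord0 -> (d i %| u 0%R i)%Z].

Lemma YQ_lattice_closed : zmod_closed (mem YQ_lattice).
Proof.
split=> [|u v]; rewrite !inE /=.
  by split=> [|i _]; rewrite ?mxE ?dvdz0 // big1 // => i _; rewrite mxE mulr0.
move=> [wu du] [wv dv]; split=> [|i i0]; last first.
  by rewrite !mxE; apply: rpredB; [exact: du|exact: dv].
under eq_bigr => i _ do rewrite !mxE mulrBr.
by rewrite sumrB wu wv subrr.
Qed.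

Lemma YQ_latticeE (a b : 'X_{1..n.+1}) :
  YQ_lattice (\row_i ((a i)%:Z - (b i)%:Z)) <->
  wdeg w a = wdeg w b /\ forall i, i != ord0 -> a i = b i %[mod d i].
Proof.
have -> : YQ_lattice (\row_i ((a i)%:Z - (b i)%:Z)) <->
    (\sum_i (w i)%:Z * ((a i)%:Z - (b i)%:Z) = 0 /\
     forall i, i != ord0 -> (d i %| (a i)%:Z - (b i)%:Z)%Z).
  rewrite /YQ_lattice /=; under eq_bigr => i _ do rewrite mxE.
  by split=> -[? h]; split=> // i /h; rewrite mxE.
under eq_bigr => i _ do rewrite mulrBr.
have sumE (c : 'X_{1..n.+1}) : \sum_i (w i)%:Z * (c i)%:Z = (wdeg w c)%:Z.
  rewrite -[RHS]natz natr_sum; apply: eq_bigr => i _.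
  by rewrite natrM !natz mulrC.
rewrite sumrB !sumE; split=> -[h1 h2]; split.
- by apply/eqP; rewrite -eqz_nat -subr_eq0 h1.
- by move=> i /h2; rewrite -eqz_mod_dvd !modz_nat => /eqP[].
- by rewrite h1 subrr.
- by move=> i /h2 h; rewrite -eqz_mod_dvd !modz_nat h.
Qed.

Lemma YQ_is_lattice_ideal : is_lattice_ideal J.
Proof.
exists YQ_lattice; first exact: YQ_lattice_closed.
apply/seteqP; split; apply: ideal_gen_min; try exact: ideal_gen_ideal.
  move=> _ [i /= i0 <-]; rewrite FgenE; apply: ideal_gen_sub.
  exists (U_(i) *+ d i)%MM, (U_(ord0) *+ (d ord0 * wt i))%MM; split=> //.
  apply/YQ_latticeE; rewrite !wdegXn; split.
    by rewrite dexp_weight mulnAC dexp0_weight.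
  move=> j j0; rewrite !mulmnE !mnm1E [ord0 == j]eq_sym (negPf j0) mul0n mod0n.
  by case: eqP => [<-|_]; rewrite ?mul0n ?mod0n // mul1n modnn.
move=> _ [a [b [/YQ_latticeE[degab modab] ->]]]; exact: mpolyX_cong.
Qed.

End Generators.

(** * Krull dimension of polynomial rings *)

Section AlgebraicDependence.
Context (F : fieldType) (N : nat).

Lemma msize_prod_exp_le (I : finType) (f : I -> {mpoly F[N]}) (a : I -> nat) D :
  (forall i, msize (f i) <= D)%N ->
  (msize (\prod_i f i ^+ a i) <= (\sum_i a i * D).+1)%N.
Proof.
(* [K p k] bounds the degree by k: [msize] is the degree plus one, and 0 for the zero polynomial. *)
move=> fD; pose K (p : {mpoly F[N]}) (k : nat) := (msize p <= k.+1)%N.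
have KM p q j k : K p j -> K q k -> K (p * q) (j + k)%N.
  rewrite /K => Kp Kq.
  have [->|p0] := eqVneq p 0; first by rewrite mul0r msize0.
  have [->|q0] := eqVneq q 0; first by rewrite mulr0 msize0.
  by rewrite msizeM // -subn1 leq_subLR add1n -addnS -addSn leq_add.
rewrite -/(K _ _); elim/big_ind2: _ => [|p j q k|i _].
- by rewrite /K msize1.
- exact: KM.
elim: (a i) => [|k IHk]; first by rewrite /K msize1.
rewrite exprS mulSn; apply: KM => //; rewrite /K.
exact: leq_trans (fD i) (leqnSn _).
Qed.

(* More monomials than coefficients: the exponents [a] range over [B ^ N.+1]
   choices and the resulting polynomials over fewer than that many monomials. *)
Lemma algebraic_dependence (f : 'I_N.+1 -> {mpoly F[N]}) :
  exists (B : nat) (c : {ffun 'I_N.+1 -> 'I_B} -> F),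
    (exists a, c a != 0) /\ \sum_a c a *: \prod_i f i ^+ a i = 0.
Proof.
pose D := (\max_i msize (f i))%N.
(* The products have degree below [E], and E <= B * (N.+1 * D).+1. Since B exceeds (N.+1 * D).+1 ^
   N, it follows that E ^ N < B ^ N.+1. *)
pose B := ((N.+1 * D).+1 ^ N).+1; pose E := (N.+1 * (B * D)).+1.
pose T := {ffun 'I_N.+1 -> 'I_B}; pose U := {ffun 'I_N -> 'I_E}.
have ltUT : (#|U| < #|T|)%N.
  rewrite !card_ffun !card_ord expnS.
  apply: (@leq_ltn_trans ((B * (N.+1 * D).+1) ^ N)%N).
    have expS x y k : (x <= y -> x ^ k <= y ^ k)%N.
      by move=> xy; elim: k => // k IHk; rewrite !expnS leq_mul.
    apply: expS; rewrite /E mulnS mulnCA.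
    by rewrite -add1n leq_add2r.
  by rewrite expnMn mulnC ltn_pmul2r ?expn_gt0.
(* Rows are the products, columns the monomials with exponents below [E]; a nonzero vector of the
   left kernel is the relation sought. *)
pose A := \matrix_(r < #|T|, s < #|U|)
  (\prod_i f i ^+ (enum_val r : T) i)@_[multinom ((enum_val s : U) j : nat) | j < N].
have : kermx A != 0.
  by rewrite kermx_eq0 /row_free neq_ltn (leq_ltn_trans (rank_leq_col A)).
move=> /rowV0Pn[v /sub_kermxP vA v0].
exists B, (fun a => v 0 (enum_rank a)); split.
  move: v0 => /eqP v0; apply/existsP; apply: contra_notT v0 => /existsPn h.
  apply/rowP => r; rewrite mxE; apply/eqP.
  by have := h (enum_val r); rewrite negbK enum_valK.
apply/mpolyP => m; rewrite mcoeff0 raddf_sum /=.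
case: (boolP [forall j, m j < E]%N) => [/forallP mE|/forallPn[j]].
  pose u : U := [ffun j => Ordinal (mE j)].
  have /rowP/(_ (enum_rank u)) := vA; rewrite !mxE => {2}<-.
  rewrite (reindex enum_rank) /=; last by apply: onW_bij; exact: enum_rank_bij.
  apply: eq_bigr => a _; rewrite mcoeffZ mxE !enum_rankK; congr (_ * _@__).
  by apply/mnmP => j; rewrite mnmE ffunE.
rewrite -leqNgt => Em; apply: big1 => a _; rewrite mcoeffZ.
rewrite [X in _ * X]memN_msupp_eq0 ?mulr0 //; apply: msize_mdeg_ge.
apply: (@leq_trans (m j)); last by rewrite mdegE (bigD1 j) ?leq_addr.
apply: leq_trans _ Em; apply: leq_trans (@msize_prod_exp_le _ f (fun i => a i) D _) _.
  by move=> i; exact: leq_bigmax.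
have -> : E = (\sum_(i < N.+1) B * D).+1 by rewrite sum_nat_const card_ord.
rewrite ltnS leq_sum // => i _.
by rewrite leq_mul2r (ltnW (ltn_ord _)) orbT.
Qed.

End AlgebraicDependence.

Lemma prime_idealX (S : comNzRingType) (P : set S) f k :
  prime_ideal P -> P (f ^+ k) -> P f.
Proof.
move=> /prime_ideal_elim[_ P1 PM]; elim: k => [/P1//|k IHk].
by rewrite exprS => /PM[].
Qed.

(* Coquand and Lombardi: evaluate an algebraic relation at [f i] in
   [C i.+1] but not in [C i]; along the chain one cancels powers of [f k] and
   discards its multiples, until only the lexicographically least monomial is
   left, and its nonzero coefficient lies in the last prime. *)
Lemma krull_dim_mpoly (F : fieldType) (N : nat) (C : nat -> set {mpoly F[N]}) :
  (forall k, (k <= N.+1)%N -> prime_ideal (C k)) ->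
  (forall k, (k <= N)%N -> C k `<` C k.+1) -> False.
Proof.
move=> primeC ltC.
have /choice[f fC] : forall i : 'I_N.+1, exists x, C i.+1 x /\ ~ C i x.
  move=> i; have [_ /nonsubset] := ltC i (ltn_ord i).
  by move=> [x [Cx nCx]]; exists x.
have [B [c [[a0 ca0] rel]]] := algebraic_dependence f.
pose T := {ffun 'I_N.+1 -> 'I_B}.
pose agree k (b a : T) := [forall i : 'I_N.+1, (i < k)%N ==> (a i == b i)].
(* At stage k the factors [f i] with i < k are gone and only the exponents sharing the first k
   entries of [b] remain; at [N.+1] this is [c b] alone. *)
suff claim k : (k <= N.+1)%N -> exists2 b, c b != 0 &
    C k (\sum_(a | agree k b a) c a *: \prod_(i < N.+1 | (k <= i)%N) f i ^+ a i).
  have [b cb] := claim N.+1 (leqnn _).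
  rewrite (big_pred1 b) => [|a]; last first.
    apply/forallP/eqP => [h|-> i]; last by rewrite eqxx implybT.
    by apply/ffunP => i; apply/eqP; have := h i; rewrite ltn_ord.
  rewrite big_pred0 => [|i]; last by rewrite leqNgt ltn_ord.
  have [[_ _ CM] C1 _] := prime_ideal_elim (primeC _ (leqnn N.+1)).
  move=> /(CM (c b)^-1%:MP); rewrite mul_mpolyC scalerA mulVf // scale1r.
  exact: C1.
elim: k => [_|k IHk ltk].
  exists a0 => //; have [[C0 _ _] _ _] := prime_ideal_elim (primeC 0%N isT).
  rewrite (eq_bigl predT) => [|a]; last by apply/forallP.
  by move: rel => ->.
have [b cb] := IHk (ltnW ltk).
pose o := Ordinal ltk; have [fo nfo] := fC o.
have bP : agree k b b && (c b != 0).
  by rewrite cb andbT; apply/forallP => i; rewrite eqxx implybT.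
(* The least power of [f o] among the terms with nonzero coefficient is factored out and cancelled,
   as [C k] is prime and misses [f o]. *)
case: (@arg_minnP T b (fun a => agree k b a && (c a != 0)) (fun a => a o) bP).
move=> b' /andP[bb' cb'] minb'.
pose G (a : T) := c a *: (f o ^+ (a o - b' o)
  * \prod_(i < N.+1 | (k < i)%N) f i ^+ a i).
rewrite (eq_bigr (fun a => f o ^+ b' o * G a)) => [|a aP]; last first.
  (* The subtraction in [G] can truncate only where [c a] is zero, and there the term vanishes. *)
  rewrite /G -scalerAr; have [->|ca] := eqVneq (c a) 0; first by rewrite !scale0r.
  rewrite mulrA -exprD subnKC ?minb' ?aP // (bigD1 o) //=; congr (_ *: (_ * _)).
  by apply: eq_bigl => i; rewrite ltn_neqAle -val_eqE /= andbC eq_sym.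
rewrite -mulr_sumr.
have [idC' _ _] := prime_ideal_elim (primeC _ ltk).
have [_ _ CM] := prime_ideal_elim (primeC _ (ltnW ltk)).
move=> /CM[/(prime_idealX (primeC _ (ltnW ltk)))//|CG]; exists b' => //.
have {CG}CG : C k.+1 (\sum_(a | agree k b a) G a).
  by case: (ltC k ltk) => + _; apply.
move: CG; rewrite (bigID (fun a : T => a o == b' o)) /= => CG.
(* A larger exponent leaves a factor [f o], which lies in [C k.+1]. *)
have CG2 : C k.+1 (\sum_(a | agree k b a && (a o != b' o)) G a).
  apply: (is_ideal_sum idC') => a _ /andP[aP neq]; rewrite /G.
  have [->|ca] := eqVneq (c a) 0; first by rewrite scale0r; case: idC'.
  have lt : (b' o < a o)%N by rewrite ltn_neqAle eq_sym neq minb' ?aP.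
  rewrite -subn_gt0 in lt; rewrite -(prednK lt) exprS -mulrA scalerAr mulrC.
  by case: idC' => _ _; apply.
have := is_idealB idC' CG CG2; rewrite addrK.
congr (C _ _); apply: eq_big => [a|a /andP[_ /eqP ao]]; last first.
  by rewrite /G ao subnn expr0 mul1r.
apply/andP/forallP => [[/forallP ab /eqP ao] i|ab'].
  apply/implyP; rewrite ltnS leq_eqVlt => /orP[/eqP ik|ik].
    by rewrite (_ : i = o) ?ao //; apply/val_inj.
  by move: (ab i) (forallP bb' i); rewrite ik /= => /eqP -> /eqP ->.
split; last by move: (ab' o); rewrite /= leqnn => /eqP ->.
apply/forallP => i; apply/implyP => ik.
by move: (ab' i) (forallP bb' i); rewrite ik ltnW //= => /eqP -> /eqP ->.
Qed.

Lemma prime_chain_lt (F : fieldType) (N r : nat) (P Q : set {mpoly F[N]}) :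
  prime_chain P r -> prime_ideal Q -> P `<` Q -> (r < N)%N.
Proof.
move=> [C [primeC ltC CP]] primeQ PQ; rewrite ltnNge; apply/negP => leNr.
(* [Q] is appended to the chain; as N <= r, the indices up to [N.+1] reach it at most once. *)
pose C' k := if (k <= r)%N then C (inord k) else Q.
apply: (@krull_dim_mpoly F N C') => k lek; rewrite /C'; first by case: ifP.
rewrite (leq_trans lek leNr); case: ifP => [ltk|].
  by apply: ltC; rewrite !inordK ?ltnS // ltnW.
move/negbT; rewrite -leqNgt => lerk.
have -> : inord k = ord_max :> 'I_r.+1; last by rewrite CP.
apply/val_inj; rewrite /= inordK ?ltnS ?(leq_trans lek) //.
by apply/eqP; rewrite eqn_leq lerk (leq_trans lek).
Qed.

(** * Height *)

Lemma mmap_rmorphism (R S : comNzRingType) (n : nat)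
    (psi : {rmorphism {mpoly R[n]} -> S}) (f : R -> S) (h : 'I_n -> S) :
  (forall c, psi c%:MP = f c) -> (forall i, psi 'X_i = h i) -> mmap f h =1 psi.
Proof.
move=> psiC psiX p; rewrite [in RHS](mpolyE p) rmorph_sum; apply: eq_bigr => a _.
rewrite -mul_mpolyC rmorphM psiC; congr (_ * _).
rewrite mpolyXE_id rmorph_prod; apply: eq_bigr => i _.
by rewrite rmorphXn psiX.
Qed.

Section LowerChain.
Context (F : fieldType) (n : nat) (D : idomainType).
Context (pi : {rmorphism {mpoly F[n.+1]} -> D}).

(* With [pi] the projection onto S/P: [x_0, ..., x_k] are sent to their classes. *)
Definition partial_sub_var (k : nat) (i : 'I_n.+1) : {mpoly D[n.+1]} :=
  if (i <= k)%N then (pi 'X_i)%:MP else 'X_i.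

Definition partial_sub (k : nat) : {rmorphism {mpoly F[n.+1]} -> {mpoly D[n.+1]}} :=
  mmap (@mpolyC n.+1 D \o pi \o @mpolyC n.+1 F) (partial_sub_var k).

Lemma partial_subX k i : partial_sub k 'X_i = partial_sub_var k i.
Proof. by rewrite /= mmapX mmap1U. Qed.

Lemma partial_subC k c : partial_sub k c%:MP = (pi c%:MP)%:MP.
Proof. by rewrite /= mmapC. Qed.

Lemma partial_sub_full k (f : {mpoly F[n.+1]}) :
  (n <= k)%N -> partial_sub k f = (pi f)%:MP.
Proof.
move=> lenk; apply: (@mmap_rmorphism _ _ _ (@mpolyC n.+1 D \o pi)) => // i /=.
by rewrite /partial_sub_var (leq_trans _ lenk) // -ltnS.
Qed.

Lemma partial_sub_ker_le j k (f : {mpoly F[n.+1]}) :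
  (j <= k)%N -> partial_sub j f = 0 -> partial_sub k f = 0.
Proof.
move=> lejk fj0.
(* [sigma] substitutes the classes of the variables with index in (j, k], so [partial_sub k] factors
   through [partial_sub j]. *)
pose sigma : {rmorphism {mpoly D[n.+1]} -> {mpoly D[n.+1]}} :=
  mmap (@mpolyC n.+1 D) (partial_sub_var k).
suff -> : partial_sub k f = sigma (partial_sub j f) by rewrite fj0 rmorph0.
apply: (@mmap_rmorphism _ _ _ (sigma \o partial_sub j)) => [c|i].
  by rewrite /= partial_subC /= mmapC.
rewrite /= partial_subX /partial_sub_var; case: ifP => leij.
  by rewrite /= mmapC (leq_trans leij lejk).
by rewrite /= mmapX mmap1U.
Qed.

End LowerChain.

Lemma prime_chain_integral (F : fieldType) (n : nat) (P : set {mpoly F[n.+1]})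
    (d e : 'I_n.+1 -> nat) :
  prime_ideal P -> (forall i, 0 < d i)%N ->
  (forall i, i != ord0 -> P ('X_i ^+ d i - 'X_ord0 ^+ e i)) ->
  prime_chain P n.
Proof.
move=> /prime_ideal_is_ker[D [pi ->]] d_gt0 Pde.
exists (fun k : 'I_n.+1 => [set f | partial_sub pi k f = 0]); split.
- by move=> k; exact: prime_ideal_ker.
- move=> j k ltjk; split=> [f|]; first exact/partial_sub_ker_le/ltnW.
  have k0 : k != ord0 by rewrite -val_eqE -lt0n (leq_ltn_trans _ ltjk).
  (* Strictness: this relation dies once x_k is replaced by its class, whereas for j < k its image
     is monic in the free variable x_k, with the other term a constant of [D]. *)
  move=> /(_ ('X_k ^+ d k - 'X_ord0 ^+ e k)) /=.
  have subE l : partial_sub pi l ('X_k ^+ d k - 'X_ord0 ^+ e k) =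
      partial_sub_var pi l k ^+ d k - ((pi 'X_ord0) ^+ e k)%:MP.
    by rewrite rmorphB !rmorphXn !partial_subX.
  have := Pde k k0; rewrite /= rmorphB !rmorphXn => /subr0_eq powE.
  rewrite !subE /partial_sub_var leqnn leqNgt ltjk -{1}powE rmorphXn /= subrr.
  move=> /(_ erefl).
  move=> /(congr1 (mcoeff (U_(k) *+ d k)%MM)) /eqP.
  rewrite mpolyXn mcoeffB mcoeffX eqxx mcoeffC mcoeff0.
  have /negPf -> : (U_(k) *+ d k != 0)%MM.
    apply/eqP => /mnmP/(_ k); rewrite mulmnE mnm1E eqxx mnm0E mul1n => dk.
    by have := d_gt0 k; rewrite dk.
  by rewrite mulr0 subr0 oner_eq0.
- apply/seteqP; split=> f /=; rewrite partial_sub_full //.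
    by move=> /eqP; rewrite mpolyC_eq0 => /eqP.
  by move=> ->; rewrite mpolyC0.
Qed.

(** * Height of the ideal of the F_i and complete intersection *)

Section CompleteIntersection.
Context (F : finFieldType) (n : nat) (w : 'I_n.+1 -> nat).
Hypothesis w_gt0 : forall i, (0 < w i)%N.
Hypothesis hw0 : (w ord0 %| #|F|.-1)%N.

Local Notation d := (dexp F w).
Local Notation wt := (wtilde F w).
Local Notation J := (ideal_gen [set Fgen F w i | i in [set i | i != ord0]]).

Lemma Fgen_ideal_height : ideal_height J n.
Proof.
have heightP (P : set {mpoly F[n.+1]}) :
    prime_ideal P -> J `<=` P -> prime_chain P n.
  move=> primeP JP.
  apply: (@prime_chain_integral _ _ P d (fun i => d ord0 * wt i)%N) => // i.
    exact: dexp_gt0.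
  by move=> i0; apply: JP; exact: Fgen_in.
split=> [|P s primeP JP [_]]; last by apply; exact: heightP.
pose psi : {rmorphism {mpoly F[n.+1]} -> {poly F}} :=
  mmap (@polyC F) (fun i => 'X^(w i)).
pose P : set {mpoly F[n.+1]} := [set f | psi f = 0].
have primeP : prime_ideal P by exact: prime_ideal_ker.
have JP : J `<=` P.
  apply: ideal_gen_min; first by case: (prime_ideal_elim primeP).
  move=> _ [i /= i0 <-]; rewrite /P /= /Fgen rmorphB !rmorphXn /= !mmapX !mmap1U.
  rewrite -!exprM !(mulnC (w _)) dexp_weight // mulnAC dexp0_weight //.
  by rewrite subrr.
exists P; split=> //; split; first exact: heightP.
move=> s chainP.
pose Q : set {mpoly F[n.+1]} := [set f | f.@[fun=> 0] = 0].
have primeQ : prime_ideal Q.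
  exact: (@prime_ideal_ker _ _ (meval (fun=> 0) : {rmorphism {mpoly F[n.+1]} -> F})).
rewrite -ltnS; apply: (prime_chain_lt chainP primeQ); split=> [f|QP].
  rewrite /P /Q /= => psif.
  (* All [w i] are positive, so the constant term of [psi f] is f(0); the kernel thus lies in the
     ideal of the origin. *)
  have := @mmap_rmorphism F F n.+1 (horner_eval 0 \o psi) idfun (fun=> 0).
  rewrite /meval => ->;
    [by rewrite /= psif horner_evalE horner0|move=> c|move=> i] => /=.
    by rewrite mmapC horner_evalE hornerC.
  by rewrite mmapX mmap1U horner_evalE hornerXn expr0n (gtn_eqF (w_gt0 i)).
have /QP : Q 'X_ord0 by rewrite /Q /= mevalXU.
by rewrite /P /= mmapX mmap1U => /eqP; rewrite (negPf (monic_neq0 (monicXn _ _))).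
Qed.

Lemma Fgen_complete_intersection : complete_intersection J.
Proof.
exists n; first exact: Fgen_ideal_height.
exists (fun k => Fgen F w (lift ord0 k)); split.
(* The generators are told apart at the coordinate points: F_j is 1 at the j-th one, where every
   other F_k is 0. *)
- move=> j k /(congr1 (meval (fun i => (i == lift ord0 j)%:R))).
  rewrite /Fgen !rmorphB !rmorphXn /= !mevalXU eqxx expr1n.
  rewrite (negPf (neq_lift _ _)) !expr0n !muln_eq0 !(gtn_eqF (dexp_gt0 F w _)).
  rewrite !(gtn_eqF (wtilde_gt0 F w_gt0 _)) !subr0 (inj_eq lift_inj).
  case: eqP => // _ /eqP.
  by rewrite expr0n (gtn_eqF (dexp_gt0 F w _)) oner_eq0.
- move=> k; exists (U_(lift ord0 k) *+ d (lift ord0 k))%MM.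
  by exists (U_(ord0) *+ (d ord0 * wt (lift ord0 k)))%MM; exact: FgenE.
congr ideal_gen; apply/seteqP; split=> [_ [i /= i0 <-]|_ [k _ <-]].
  by case: (unliftP ord0 i) i0 => [k -> _|->]; [exists k|rewrite eqxx].
by exists (lift ord0 k).
Qed.

End CompleteIntersection.

Theorem proposition3p3 (F : finFieldType) (K : closedFieldType)
    (iota : {rmorphism F -> K}) (hK : is_algebraic_closure iota)
    (n : nat) (hn : (1 <= n)%N)
    (w : 'I_n.+1 -> nat) (w_gt0 : forall i, (0 < w i)%N)
    (w_gcd : forall (i : 'I_n.+1) (d : nat),
      (forall j : 'I_n.+1, j != i -> (d %| w j)%N) -> (d <= 1)%N)
    (hw0 : (w ord0 %| #|F|.-1)%N) :
  let J := ideal_gen [set Fgen F w i | i in [set i | i != ord0]] in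
  [/\ vanishing_ideal iota (YQ iota w) = J,
      complete_intersection J
    & is_lattice_ideal J].
Proof.
split; [exact: vanishing_ideal_YQ|exact: Fgen_complete_intersection|].
exact: YQ_is_lattice_ideal.
Qed.
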